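(* Let $q$ be a complex number with $0<|q|<1$, and let $q^{1/2}$ be a fixed square root of $q$. For any nonnegative integer $n$ we have $$\frac{(q;q^{2})_{\infty}}{(q^{2};q^{2})_{\infty}}\sum_{j=0}^{n}q^{j(j+1)/2}=1+(-1)^{n}q^{n(n+1)/2}\sum_{l=n+1}^{\infty}(-q)^{l}\left(\sum_{j=0}^{l}\frac{(q^{-n-1/2};q)_{j}\,(q^{1/2};q)_{l-j}}{(q;q)_{j}\,(q;q)_{l-j}}(-q^{n+1})^{j}\right){l-1 \brack n}_{q}.$$
   Context: For complex $p$ with $|p|<1$ and complex $z$, $(z;p)_{\infty}:=\prod_{m=0}^{\infty}(1-zp^{m})$. For a nonnegative integer $l$, $(z;p)_{l}:=\frac{(z;p)_{\infty}}{(zp^{l};p)_{\infty}}$, that is, $(z;p)_{l}=\prod_{m=0}^{l-1}(1-zp^{m})$ (with $(z;p)_0=1$). The $q$-binomial coefficient is ${M \brack N}_{q}:=\frac{(q;q)_{M}}{(q;q)_{N}(q;q)_{M-N}}$ if $0\le N\le M$, and $0$ otherwise. Half-integer powers of $q$ are powers of the fixed $q^{1/2}$, i.e. $q^{-n-1/2}=(q^{1/2})^{-2n-1}$. *)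

(* Defs.v *)
From HB Require Import structures.
From mathcomp Require Import all_boot all_order all_algebra complex.
From mathcomp Require Import all_classical all_reals all_analysis.

Set Implicit Arguments.
Unset Strict Implicit.
Unset Printing Implicit Defensive.

Import Order.TTheory GRing.Theory Num.Theory.
Import numFieldNormedType.Exports.

Local Open Scope classical_set_scope.
Local Open Scope ring_scope.

(* R[i] seen as an abstract numeric field, so that the topology of the norm,
   which numFieldNormedType attaches to numFieldType, is inferred for it. *)
Definition Cplx (R : realType) : numClosedFieldType := R[i].

(* (z; p)_l.  The product form makes sense also when (z p^l; p)_oo = 0, where
   the quotient (z; p)_oo / (z p^l; p)_oo is 0 / 0. *)
Definition qpoch (K : numFieldType) (z p : K) (l : nat) : K :=
  \prod_(0 <= m < l) (1 - z * p ^+ m).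

(* limn is total; it is meaningful here when `|p| < 1, where the partial
   products converge. *)
Definition qpoch_inf (K : numFieldType) (z p : K) : K :=
  limn (fun l : nat => qpoch z p l).

Definition qbinom (K : numFieldType) (q : K) (M N : nat) : K :=
  if (N <= M)%N then qpoch q q M / (qpoch q q N * qpoch q q (M - N)) else 0.

(* Main.v *)
Require Import Defs.
From HB Require Import structures.
From mathcomp Require Import all_boot all_order all_algebra complex.
From mathcomp Require Import all_classical all_reals all_analysis.
From mathcomp Require Import ring.
Import Order.TTheory GRing.Theory Num.Theory.
Import numFieldNormedType.Exports.
Local Open Scope classical_set_scope.
Local Open Scope ring_scope.

(** Let [G(x)] be the generating function of the inner sums over [j].  As a
    Cauchy product of two q-binomial series it is an explicit quotient of
    infinite products.

    As a function of [x = q ^+ l], the q-binomial coefficient [l - 1] over [n] is,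
    up to the factor [(-1) ^+ n * q ^+ 'C(n.+1, 2)] in front of the series, the
    product of the [x - q ^+ m], [1 <= m <= n], divided by [qpoch q q n].  This
    vanishes for [1 <= l <= n] and is 1 for [l = 0], so the summand 1 of the
    right side is the missing term [l = 0], and the right side is a sum over all
    [l].  Expanding the product in powers of [q ^+ l] ([prod_sub_expr]) turns it
    into a combination of the values [G(- q ^+ k.+1)], [0 <= k <= n].  Each value is
    [gauss_quotient q] times a finite product ([qbin_sum_mul]).

    What remains is a terminating identity ([bailey_beta_sum]): a sum over
    [k <= n] equals the sum of the [q ^+ 'C(j.+1, 2)], [j <= n].  Its increment in
    [n] is a sum that q-Saalschuetz evaluates: [bailey_alpha_sum] says that
    [bailey_beta], times [1 - q], and [q ^+ 'C(n.+1, 2)] form a Bailey pair.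

    The q-binomial theorem itself follows from the functional equation relating
    the sums at [y] and [q * y]; convergence and multiplication of the series
    follow from geometric bounds on their terms. *)

(** * Finite products and the terminating identity *)

Lemma qpoch0 {K : numFieldType} (z p : K) : qpoch z p 0 = 1.
Proof. by rewrite /qpoch big_geq. Qed.

Lemma qpochS {K : numFieldType} (z p : K) l :
  qpoch z p l.+1 = qpoch z p l * (1 - z * p ^+ l).
Proof. by rewrite /qpoch big_nat_recr. Qed.

Lemma qpochD {K : numFieldType} (z p : K) k l :
  qpoch z p (k + l) = qpoch z p k * qpoch (z * p ^+ k) p l.
Proof.
elim: l => [|l IHl]; first by rewrite addn0 qpoch0 mulr1.
by rewrite addnS !qpochS IHl exprD !mulrA.
Qed.

Lemma qpoch_neq0 {K : numFieldType} (z p : K) l :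
  `|z| < 1 -> `|p| <= 1 -> qpoch z p l != 0.
Proof.
move=> z1 p1; elim: l => [|l IHl]; first by rewrite qpoch0 oner_neq0.
rewrite qpochS mulf_neq0 // subr_eq0; apply/eqP => /(congr1 Num.norm).
rewrite normr1 normrM normrX => h.
have : `|z| * `|p| ^+ l < 1.
  by apply: le_lt_trans z1; rewrite ler_piMr // exprn_ile1.
by rewrite -h ltxx.
Qed.

Lemma expr_binS {K : comNzRingType} (q : K) m :
  q ^+ 'C(m.+1, 2) = q ^+ 'C(m, 2) * q ^+ m.
Proof. by rewrite binS bin1 exprD. Qed.

(** The coefficient of [x ^+ k] in the product of the [x - q ^+ m], for
    [1 <= m <= n], over [qpoch q q n]. *)
Definition qprod_coef {K : numFieldType} (q : K) (n k : nat) : K :=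
  (-1) ^+ (n - k) * q ^+ 'C((n - k).+1, 2) / (qpoch q q k * qpoch q q (n - k)).

(** Finite q-binomial theorem, by the q-Pascal rule for [qprod_coef].  The
    product is over [x - q ^+ m] rather than [1 - x * q ^- m] so that no
    negative power of [q] occurs. *)
Lemma prod_sub_expr {K : numFieldType} (q x : K) n : `|q| < 1 ->
  (\prod_(0 <= m < n) (x - q ^+ m.+1)) / qpoch q q n =
  \sum_(0 <= k < n.+1) qprod_coef q n k * x ^+ k.
Proof.
move=> q1; have nz l : qpoch q q l != 0 by rewrite qpoch_neq0 // ltW.
have nz1 l : 1 - q * q ^+ l != 0.
  by apply: contraNneq (nz l.+1) => h; rewrite qpochS h mulr0.
elim: n => [|n IHn].
  by rewrite big_geq // big_nat1 /qprod_coef !qpoch0 !mulr1 invr1.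
have rec0 : qprod_coef q n.+1 0 * (1 - q * q ^+ n) =
    - q ^+ n.+1 * qprod_coef q n 0.
  rewrite /qprod_coef !subn0 (expr_binS q n.+1) qpochS !(exprS _ n).
  by field; rewrite nz nz nz1.
have recn : qprod_coef q n.+1 n.+1 * (1 - q * q ^+ n) = qprod_coef q n n.
  by rewrite /qprod_coef !subnn qpochS; field; rewrite !nz nz1.
have recS k : (k < n)%N -> qprod_coef q n.+1 k.+1 * (1 - q * q ^+ n) =
    qprod_coef q n k - q ^+ n.+1 * qprod_coef q n k.+1.
  move=> kn; have [m ->] : exists m, n = (m + k.+1)%N.
    by exists (n - k.+1)%N; rewrite subnK.
  rewrite /qprod_coef subSS addnK addnS subSn ?leq_addl // addnK.
  rewrite (expr_binS q m.+1) !qpochS (exprS q (m + k).+1) !(exprS q (m + k)).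
  rewrite exprD !(exprS q m) (exprS (-1) m).
  by field; rewrite !nz !nz1.
apply: (mulIf (nz1 n)).
transitivity ((\prod_(0 <= m < n) (x - q ^+ m.+1)) / qpoch q q n
               * (x - q ^+ n.+1)).
  by rewrite big_nat_recr //= qpochS; field; rewrite nz nz1.
rewrite IHn mulrBr !mulr_suml big_nat_recr //= [X in _ - X]big_nat_recl //.
rewrite big_nat_recr //= [X in _ = X + _]big_nat_recl //.
have -> : \sum_(0 <= i < n) qprod_coef q n.+1 i.+1 * x ^+ i.+1 * (1 - q * q ^+ n)
  = \sum_(0 <= i < n) qprod_coef q n i * x ^+ i * x
    - \sum_(0 <= i < n) qprod_coef q n i.+1 * x ^+ i.+1 * q ^+ n.+1.
  rewrite -sumrB; apply: eq_big_nat => i /andP[_ lt_in].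
  by rewrite mulrAC recS // (exprS x i); ring.
rewrite [X in _ = X + _ + _]mulrAC rec0 [X in _ = _ + X]mulrAC recn (exprS x n).
by ring.
Qed.

(** Times [1 - q], this is the sequence [beta] of a Bailey pair relative to
    [a = q]; the corresponding [alpha] turns out to be [q ^+ 'C(n.+1, 2)]. *)
Definition bailey_beta {K : numFieldType} (q : K) k : K :=
  qpoch (- q) q k / (qpoch q q k * qpoch q (q ^+ 2) k.+1).

(** The terms of the inverse Bailey transform: their sum over [k <= n] is the
    [alpha] that belongs to [(1 - q) * bailey_beta q k]. *)
Definition bailey_alpha_term {K : numFieldType} (q : K) n k : K :=
  (1 - q ^+ (2 * n).+1) * (-1) ^+ (n - k) * q ^+ 'C(n - k, 2) *
  (qpoch q q (n + k) / qpoch q q (n - k)) * bailey_beta q k.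

Section BaileyPair.
Variables (K : numFieldType) (q : K).
Hypotheses (q0 : q != 0) (q1 : `|q| < 1).

Let nz l : qpoch q q l != 0. Proof. by rewrite qpoch_neq0 // ltW. Qed.

Let nz1 l : 1 - q * q ^+ l != 0.
Proof. by apply: contraNneq (nz l.+1) => h; rewrite qpochS h mulr0. Qed.

Let nz2 l : qpoch q (q ^+ 2) l != 0.
Proof. by rewrite qpoch_neq0 // normrX exprn_ile1 // ltW. Qed.

Let nz3 l : 1 - q * (q ^+ 2) ^+ l != 0.
Proof. by apply: contraNneq (nz2 l.+1) => h; rewrite qpochS h mulr0. Qed.

Let nzX l : q ^+ l != 0. Proof. exact: expf_neq0. Qed.

Let bailey_betaS k : bailey_beta q k.+1 = bailey_beta q k *
  (1 + q * q ^+ k) / ((1 - q * q ^+ k) * (1 - q * (q * q ^+ k) ^+ 2)).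
Proof.
rewrite /bailey_beta qpochS (qpochS q q) (qpochS q (q ^+ 2)) mulNr -(exprS q k).
rewrite (exprAC q 2 k.+1).
have h1 := nz1 k; have h3 := nz3 k.+1.
rewrite -(exprS q k) in h1; rewrite exprAC in h3.
by field; rewrite !nz !nz2 h1 h3.
Qed.

(** The terms are those of a balanced terminating 3phi2, so the sum is
    hypergeometric in [n] (q-Saalschuetz).  The first order recurrence is proved
    by telescoping, with the q-Zeilberger certificate [g]. *)
Lemma bailey_alpha_sumS n :
  \sum_(0 <= k < n.+2) bailey_alpha_term q n.+1 k =
  q ^+ n.+1 * \sum_(0 <= k < n.+1) bailey_alpha_term q n k.
Proof.
(* Written with [q ^+ n.+1 / q ^+ k] and [n.+1 - k], so that [g n.+1] makes
   sense; it is minus the term [k = n.+1], the only one without a counterpart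
   in the sum for [n]. *)
pose g k := - (q ^+ n.+1 * (1 + q ^+ n.+1) / q ^+ k * (1 - q ^+ k) *
  (1 - q * (q ^+ k) ^+ 2) * (-1) ^+ (n.+1 - k) * q ^+ 'C(n.+1 - k, 2) *
  (qpoch q q (n + k) / qpoch q q (n.+1 - k)) * bailey_beta q k).
have gE k : (k <= n)%N ->
    g k.+1 - g k = bailey_alpha_term q n.+1 k - q ^+ n.+1 * bailey_alpha_term q n k.
  move=> kn; rewrite /g /bailey_alpha_term subSS !subSn //.
  have [m ->] : exists m, n = (m + k)%N by exists (n - k)%N; rewrite subnK.
  rewrite addnK bailey_betaS !expr_binS !mul2n -!addnn !(addnS, addSn) !qpochS.
  rewrite !(exprS (-1)) !(exprS q k) !(exprS q (m + k)) !exprD.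
  rewrite !(exprS q (m + k + (m + k)).+2) !(exprS q (m + k + (m + k)).+1).
  rewrite !(exprS q (m + k + (m + k))) !exprD.
  have nzk : 1 - q * (q * q ^+ k) ^+ 2 != 0.
    by have := nz3 k.+1; rewrite exprAC (exprS q k).
  by field; rewrite nz q0 nzX nzk !nz1.
have g0 : g 0%N = 0 by rewrite /g expr0 subrr mulr0 !mul0r oppr0.
have gtop : bailey_alpha_term q n.+1 n.+1 = - g n.+1.
  rewrite /g /bailey_alpha_term !subnn !(addnS, addSn) !qpochS mul2n -addnn.
  rewrite !(exprS q n) !(addnS, addSn) !(exprS q (n + n).+2) (exprS q (n + n).+1).
  rewrite !(exprS q (n + n)) !exprD qpoch0.
  by field; rewrite q0 nzX.
rewrite big_nat_recr //= gtop mulr_sumr.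
rewrite (@eq_big_nat _ _ _ _ _ _
  (fun k => q ^+ n.+1 * bailey_alpha_term q n k + (g k.+1 - g k))); last first.
  by move=> k /andP[_ kn]; rewrite gE // addrC subrK.
by rewrite big_split /= telescope_sumr // g0 subr0 addrK.
Qed.

Lemma bailey_alpha_sum n :
  \sum_(0 <= k < n.+1) bailey_alpha_term q n k = q ^+ 'C(n.+1, 2).
Proof.
elim: n => [|n IHn].
  rewrite big_nat1 /bailey_alpha_term /bailey_beta !qpochS !qpoch0 /= !expr0.
  by field; have := nz1 0; rewrite mulr1.
by rewrite bailey_alpha_sumS IHn [RHS]expr_binS mulrC.
Qed.

(** Partial sums of the Bailey pair: the difference of the left sides for
    [n.+1] and [n] is, term by term, the sum of [bailey_alpha_sum] at [n.+1]. *)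
Lemma bailey_beta_sum n :
  \sum_(0 <= k < n.+1)
    qprod_coef q n k * (qpoch q q (n + k).+1 * qpoch (- q) q k
                         / qpoch q (q ^+ 2) k.+1)
  = \sum_(0 <= j < n.+1) q ^+ 'C(j.+1, 2).
Proof.
elim: n => [|n IHn].
  rewrite !big_nat1 /qprod_coef !qpochS !qpoch0 /= !expr0.
  by field; have := nz1 0; rewrite mulr1.
rewrite [RHS]big_nat_recr //= -IHn -bailey_alpha_sum addrC.
rewrite big_nat_recr // [in RHS]big_nat_recr //= addrAC -big_split /=.
congr (_ + _).
  apply: eq_big_nat => k /andP[_ kn].
  have [m ->] : exists m, n = (m + k)%N by exists (n - k)%N; rewrite subnK.
  rewrite /bailey_alpha_term /qprod_coef /bailey_beta subSn ?leq_addl // addnK.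
  rewrite !expr_binS !(addnS, addSn) !(qpochS q q) mul2n -addnn !(addnS, addSn).
  rewrite !(exprS (-1)) !(exprS q (m + k + k)) !(exprS q (m + k + (m + k)).+2).
  rewrite (exprS q (m + k + (m + k)).+1) (exprS q (m + k + (m + k))) !exprD (exprS q m).
  by field; rewrite nz2 !nz nz1.
rewrite /bailey_alpha_term /qprod_coef /bailey_beta !subnn.
rewrite !(addnS, addSn) mul2n -addnn !(addnS, addSn) (qpochS q q (n + n).+2).
rewrite !(exprS q (n + n).+2) qpoch0.
by field; rewrite nz2 nz.
Qed.

End BaileyPair.

(** * The q-binomial theorem *)

Definition qbin_term {K : numFieldType} (q a y : K) (j : nat) : K :=
  qpoch a q j / qpoch q q j * y ^+ j.

Definition qbin_sum {K : numFieldType} (q a y : K) : K :=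
  limn (series (qbin_term q a y)).

(** By Gauss, this is the reciprocal of the sum of [q ^+ 'C(j.+1, 2)] over all
    [j], so that the theorem compares a partial sum of that series with the
    whole of it. *)
Definition gauss_quotient {K : numFieldType} (q : K) : K :=
  qpoch_inf q (q ^+ 2) / qpoch_inf (q ^+ 2) (q ^+ 2).

Section QBinomial.
Context {K : numFieldType} {q : K}.
Hypothesis q1 : `|q| < 1.

(** The next three facts are all the analysis that the argument needs: the
    series converge, their sums are continuous at 0 along [y * q ^+ m], and
    they can be multiplied.  They rest on completeness and are proved below for
    the complex numbers; what is derived from them here is algebra and limits of
    explicit sequences, valid in any [K]. *)
Hypothesis qbin_cvg :
  forall a y : K, `|y| < 1 -> cvgn (series (qbin_term q a y)).
Hypothesis qbin_sum_cvg1 : forall a y : K, `|y| < 1 ->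
  (fun m => qbin_sum q a (y * q ^+ m)) @ \oo --> (1 : K).
Hypothesis qbin_cauchy : forall a y b z : K, `|y| < 1 -> `|z| < 1 ->
  series (fun l => \sum_(0 <= j < l.+1)
                     qbin_term q a y j * qbin_term q b z (l - j)) @ \oo -->
  qbin_sum q a y * qbin_sum q b z.

Let nz l : qpoch q q l != 0. Proof. by rewrite qpoch_neq0 // ltW. Qed.

Let nz1 l : 1 - q * q ^+ l != 0.
Proof. by apply: contraNneq (nz l.+1) => h; rewrite qpochS h mulr0. Qed.

(** The functional equation of the q-binomial series.  On partial sums it fails
    by the difference of two terms of convergent series, which tends to 0. *)
Lemma qbin_sum_rec a y : `|y| < 1 ->
  (1 - y) * qbin_sum q a y = (1 - a * y) * qbin_sum q a (q * y).
Proof.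
move=> y1; have qy1 : `|q * y| < 1 by rewrite normrM mulr_ilt1.
apply/eqP; rewrite -subr_eq0; apply/eqP.
pose E N := (1 - y) * series (qbin_term q a y) N -
            (1 - a * y) * series (qbin_term q a (q * y)) N.
have E1 : E @ \oo --> (1 - y) * qbin_sum q a y - (1 - a * y) * qbin_sum q a (q * y).
  by apply: cvgB; apply: cvgM; (exact: cvg_cst || exact: qbin_cvg).
have EE N : E N = qbin_term q a (q * y) N - qbin_term q a y N.
  elim: N => [|N IHN].
    by rewrite /E /series /= !big_geq // !mulr0 /qbin_term !expr0 !subrr.
  rewrite /E !seriesSr !mulrDr opprD addrACA -/(E N) IHN.
  rewrite /qbin_term !qpochS !exprMn !exprS.
  by field; rewrite nz nz1.
have E0 : E @ \oo --> (0 : K).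
  rewrite (_ : E = fun N => qbin_term q a (q * y) N - qbin_term q a y N);
    last exact/funext.
  rewrite -[X in _ --> X](subrr 0).
  by apply: cvgB; apply: cvg_series_cvg_0; apply: qbin_cvg.
exact: (cvg_unique _ E1 E0).
Qed.

Lemma qbin_sum_iter a y m : `|y| < 1 ->
  qpoch y q m * qbin_sum q a y = qpoch (a * y) q m * qbin_sum q a (y * q ^+ m).
Proof.
move=> y1; elim: m => [|m IHm]; first by rewrite !qpoch0 mulr1.
have yq1 : `|y * q ^+ m| < 1.
  apply: le_lt_trans y1; rewrite normrM normrX ler_piMr //.
  by rewrite exprn_ile1 // ltW.
rewrite !qpochS mulrAC IHm mulrAC -!mulrA; congr (_ * _).
by rewrite qbin_sum_rec // exprS [y * (q * _)]mulrCA.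
Qed.

(** For [a = 0] the iterated functional equation says that [qpoch z q m] times
    the sum of Euler's series is a sum of the same series that tends to 1.  Hence
    the infinite product converges, and it cannot vanish. *)
Lemma qpoch_cvg z : `|z| < 1 -> qpoch z q @ \oo --> (qbin_sum q 0 z)^-1
  /\ qbin_sum q 0 z != 0.
Proof.
move=> z1; have q0z : qbin_sum q 0 z != 0.
  apply/eqP => z0; have := qbin_sum_cvg1 0 _ z1.
  have -> : (fun m => qbin_sum q 0 (z * q ^+ m)) = fun=> 0.
    apply/funext => m; have := qbin_sum_iter 0 _ m z1.
    rewrite z0 mulr0 mul0r => /esym/eqP; rewrite mulf_eq0 => /orP[|/eqP //].
    have -> : qpoch 0 q m = 1 by rewrite /qpoch big1 // => i _; rewrite mul0r subr0.
    by rewrite oner_eq0.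
  move=> /(cvg_unique (@norm_hausdorff _ _) (cvg_cst _)) /esym/eqP.
  by rewrite oner_eq0.
split=> //.
rewrite (_ : qpoch z q = fun m => qbin_sum q 0 (z * q ^+ m) / qbin_sum q 0 z).
  rewrite -[X in _ --> X]mul1r; apply: cvgM (cvg_cst _).
  exact: qbin_sum_cvg1.
apply/funext => m; apply: (mulIf q0z); rewrite divfK // qbin_sum_iter //.
by rewrite mul0r /qpoch big1 ?mul1r // => i _; rewrite mul0r subr0.
Qed.

Lemma qpoch_inf_cvg z : `|z| < 1 -> qpoch z q @ \oo --> qpoch_inf z q.
Proof. by move=> /qpoch_cvg[h _]; apply/cvg_ex; eexists; exact: h. Qed.

Lemma qpoch_inf_neq0 z : `|z| < 1 -> qpoch_inf z q != 0.
Proof.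
move=> z1; have [h nz0] := qpoch_cvg _ z1.
by rewrite /qpoch_inf (cvg_lim _ h) ?invr_eq0 //; apply: norm_hausdorff.
Qed.

Lemma q_binomial_theorem a y : `|y| < 1 -> `|a * y| < 1 ->
  qbin_sum q a y = qpoch_inf (a * y) q / qpoch_inf y q.
Proof.
move=> y1 ay1; apply: (mulIf (qpoch_inf_neq0 _ y1)).
rewrite divfK ?qpoch_inf_neq0 //.
have h1 : (fun m => qpoch y q m * qbin_sum q a y) @ \oo --> qpoch_inf y q * qbin_sum q a y.
  by apply: cvgM (cvg_cst _); exact: qpoch_inf_cvg.
have h2 : (fun m => qpoch y q m * qbin_sum q a y) @ \oo --> qpoch_inf (a * y) q * 1.
  rewrite (_ : (fun _ => _) = fun m => qpoch (a * y) q m * qbin_sum q a (y * q ^+ m)).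
    by apply: cvgM; [exact: qpoch_inf_cvg | exact: qbin_sum_cvg1].
  by apply/funext => m; rewrite qbin_sum_iter.
by rewrite mulrC (cvg_unique (@norm_hausdorff _ _) h1 h2) mulr1.
Qed.

(** * The full sum over l *)

Lemma qpoch_inf_shift z k : `|z| < 1 ->
  qpoch_inf z q = qpoch z q k * qpoch_inf (z * q ^+ k) q.
Proof.
move=> z1; have zk1 : `|z * q ^+ k| < 1.
  apply: le_lt_trans z1; rewrite normrM normrX ler_piMr //.
  by rewrite exprn_ile1 // ltW.
have h1 : (fun m => qpoch z q (m + k)) @ \oo --> qpoch_inf z q.
  by rewrite cvg_shiftn; apply: qpoch_inf_cvg.
have h2 : (fun m => qpoch z q (m + k)) @ \oo -->
    qpoch z q k * qpoch_inf (z * q ^+ k) q.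
  rewrite (_ : (fun _ => _) = fun m => qpoch z q k * qpoch (z * q ^+ k) q m).
    by apply: cvgM; [exact: cvg_cst | exact: qpoch_inf_cvg].
  by apply/funext => m; rewrite addnC qpochD.
exact: (cvg_unique (@norm_hausdorff _ _) h1 h2).
Qed.

Lemma qpoch_pm z m : qpoch z q m * qpoch (- z) q m = qpoch (z ^+ 2) (q ^+ 2) m.
Proof.
elim: m => [|m IHm]; first by rewrite !qpoch0 mulr1.
by rewrite !qpochS -IHm exprAC; ring.
Qed.

Lemma qpoch_inf_pm z : `|z| < 1 ->
  qpoch_inf z q * qpoch_inf (- z) q = qpoch_inf (z ^+ 2) (q ^+ 2).
Proof.
move=> z1; apply/esym/cvg_lim; first exact: norm_hausdorff.
rewrite (_ : (fun _ => _) = fun m => qpoch z q m * qpoch (- z) q m).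
  by apply: cvgM; apply: qpoch_inf_cvg; rewrite ?normrN.
by apply/funext => m; rewrite qpoch_pm.
Qed.

(** The value at [- q ^+ k.+1] of the generating function of the inner sums of the
    theorem.  The numerators [s * q ^+ k.+1] and [- s * q ^+ k.+1] of the two
    q-binomial sums combine into a product of base [q ^+ 2]; this is what the
    half-integer power of [q] is for. *)
Lemma qbin_sum_mul (s : K) n k : q != 0 -> s ^+ 2 = q ->
  qbin_sum q (s ^- (2 * n + 1)) (q ^+ (n + k).+2) * qbin_sum q s (- q ^+ k.+1) =
  gauss_quotient q * (qpoch q q (n + k).+1 * qpoch (- q) q k / qpoch q (q ^+ 2) k.+1).
Proof.
move=> q0 sq; have s0 : s != 0 by apply: contraNneq q0 => h; rewrite -sq h expr0n.
have s1 : `|s| < 1.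
  by rewrite -(@ltr_pXn2r _ 2) ?nnegrE // -normrX sq expr1n.
have small x m : `|x| < 1 -> `|x * q ^+ m| < 1.
  move=> x1; apply: le_lt_trans x1; rewrite normrM normrX ler_piMr //.
  by rewrite exprn_ile1 // ltW.
have smallX m : `|q ^+ m.+1| < 1 by rewrite exprS; apply: small.
have Nq1 : `|- q| < 1 by rewrite normrN.
have Ns1 : `|- s| < 1 by rewrite normrN.
have e1 : s ^- (2 * n + 1) * q ^+ (n + k).+2 = s * q ^+ k.+1.
  apply: (mulfI (expf_neq0 (2 * n + 1) s0)); rewrite mulrA divff ?expf_neq0 //.
  rewrite mul1r mulrA -exprSr addn1 (_ : (2 * n).+2 = 2 * n.+1)%N ?mulnS //.
  by rewrite -mulnS exprM sq -exprD addnS addSn.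
have e2 : s * - q ^+ k.+1 = - s * q ^+ k.+1 by rewrite mulrN mulNr.
rewrite !q_binomial_theorem ?e1 ?e2 ?normrN ?small ?smallX //.
have hs := qpoch_inf_shift s k.+1 s1.
have hNs := qpoch_inf_shift (- s) k.+1 Ns1.
have hq := qpoch_inf_shift q (n + k).+1 q1.
have hNq := qpoch_inf_shift (- q) k Nq1.
rewrite -exprS in hq; rewrite mulNr -exprS in hNq.
have pmq := qpoch_inf_pm q q1.
have pms := qpoch_inf_pm s s1.
have pmk := qpoch_pm s k.+1.
have nzq := qpoch_inf_neq0 q q1; have nzNq := qpoch_inf_neq0 _ Nq1.
have nzo : qpoch q (q ^+ 2) k.+1 != 0.
  by rewrite qpoch_neq0 // normrX exprn_ile1 // ltW.
rewrite sq in pms pmk; rewrite /gauss_quotient -pmq -pms -pmk hs hNs hq hNq.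
rewrite hq hNq in nzq nzNq.
rewrite -pmk in nzo.
move: nzq nzNq nzo; rewrite !mulf_eq0 !negb_or.
move=> /andP[z1 z2] /andP[z3 z4] /andP[z5 z6].
by field; rewrite z1 z2 z3 z4 z5 z6.
Qed.

(** The q-binomial coefficient with upper index [l] is, up to a factor free of
    [l], the product of [prod_sub_expr] at [x = q ^+ l.+1]. *)
Lemma qbinom_qprod_coef n l : (n <= l)%N ->
  (-1) ^+ n * q ^+ 'C(n.+1, 2) * qbinom q l n =
  \sum_(0 <= k < n.+1) qprod_coef q n k * (q ^+ l.+1) ^+ k.
Proof.
move=> nl; rewrite -prod_sub_expr // /qbinom nl.
have [d ->] : exists d, l = (d + n)%N by exists (l - n)%N; rewrite subnK.
rewrite addnK.
have -> : \prod_(0 <= m < n) (q ^+ (d + n).+1 - q ^+ m.+1) =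
    (-1) ^+ n * q ^+ 'C(n.+1, 2) * (qpoch q q (d + n) / qpoch q q d).
  elim: n {nl} => [|n IHn].
    by rewrite big_geq // addn0 divff // bin_small // !expr0 !mulr1.
  rewrite big_nat_recl //= addnS.
  have -> : \prod_(0 <= i < n) (q ^+ (d + n).+2 - q ^+ i.+2) =
      q ^+ n * \prod_(0 <= i < n) (q ^+ (d + n).+1 - q ^+ i.+1).
    transitivity (\prod_(0 <= i < n) (q * (q ^+ (d + n).+1 - q ^+ i.+1))).
      by apply: eq_bigr => i _; rewrite mulrBr -!exprS.
    by rewrite big_split /= prodr_const_nat subn0.
  rewrite IHn (expr_binS q n.+1) qpochS (exprS (-1)).
  rewrite (exprS q (d + n).+1) (exprS q (d + n)) (exprS q n).
  by field.
by field; rewrite !nz.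
Qed.

Lemma qprod_coef_vanish n l : (0 < l <= n)%N ->
  \sum_(0 <= k < n.+1) qprod_coef q n k * (q ^+ l) ^+ k = 0.
Proof.
case: l => // l ln; rewrite -prod_sub_expr //.
rewrite (bigD1_seq l) ?iota_uniq ?mem_index_iota //=.
by rewrite subrr !mul0r.
Qed.

Lemma qprod_coef_sum n : \sum_(0 <= k < n.+1) qprod_coef q n k = 1.
Proof.
transitivity ((\prod_(0 <= m < n) (1 - q ^+ m.+1)) / qpoch q q n).
  by rewrite prod_sub_expr //; apply: eq_bigr => k _; rewrite expr1n mulr1.
rewrite /qpoch (eq_bigr (fun m => 1 - q * q ^+ m)) ?divff ?nz //.
by move=> m _; rewrite exprS.
Qed.

(** Let [H l] be the product of [prod_sub_expr] at [q ^+ l], divided by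
    [qpoch q q n], times the remaining factors of the [l]-th term.  It is 1 at
    [l = 0], vanishes for [0 < l <= n], and is proportional to [F l] beyond.  So
    the right side of the theorem is the full sum of [H], and expanding the
    product in powers of [q ^+ l] makes it a finite combination of values of the
    generating function. *)
Lemma partial_theta_expansion (s : K) n : q != 0 -> s ^+ 2 = q ->
  let F := fun l : nat =>
    (- q) ^+ l *
    (\sum_(0 <= j < l.+1)
       (qpoch (s ^- (2 * n + 1)) q j * qpoch s q (l - j)) /
       (qpoch q q j * qpoch q q (l - j)) * (- q ^+ n.+1) ^+ j) *
    qbinom q l.-1 n in
  exists L : K, (fun N => \sum_(n.+1 <= l < N) F l) @ \oo --> L /\
  gauss_quotient q * (\sum_(0 <= j < n.+1) q ^+ 'C(j.+1, 2)) =
  1 + (-1) ^+ n * q ^+ 'C(n.+1, 2) * L.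
Proof.
move=> q0 sq F; set e := (-1) ^+ n * q ^+ 'C(n.+1, 2).
have e0 : e != 0 by rewrite mulf_neq0 // expf_neq0 // oppr_eq0 oner_neq0.
set T := \sum_(0 <= j < n.+1) _.
pose a := s ^- (2 * n + 1).
pose w k l := \sum_(0 <= j < l.+1)
  qbin_term q a (q ^+ (n + k).+2) j * qbin_term q s (- q ^+ k.+1) (l - j).
pose c l := \sum_(0 <= j < l.+1)
       (qpoch a q j * qpoch s q (l - j)) /
       (qpoch q q j * qpoch q q (l - j)) * (- q ^+ n.+1) ^+ j.
have wE k l : w k l = (- q) ^+ l * c l * (q ^+ l) ^+ k.
  rewrite mulrAC mulr_sumr; apply: eq_big_nat => j /andP[_ jl].
  have -> : (- q) ^+ l * (q ^+ l) ^+ k = (- q ^+ k.+1) ^+ j * (- q ^+ k.+1) ^+ (l - j).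
    by rewrite -exprD subnKC // exprAC -exprMn mulNr -exprS.
  rewrite /qbin_term.
  have -> : q ^+ (n + k).+2 = - q ^+ n.+1 * - q ^+ k.+1.
    by rewrite mulrNN -exprD addnS addSn.
  by rewrite exprMn; field; rewrite !nz.
pose H l := \sum_(0 <= k < n.+1) qprod_coef q n k * w k l.
have HE l : H l = (- q) ^+ l * c l *
    \sum_(0 <= k < n.+1) qprod_coef q n k * (q ^+ l) ^+ k.
  by rewrite mulr_sumr; apply: eq_bigr => k _; rewrite wE mulrCA.
have HF l : (n < l)%N -> H l = e * F l.
  by case: l => // l nl; rewrite HE -qbinom_qprod_coef // /F -/(c l.+1) mulrCA.
have H0 : H 0%N = 1.
  rewrite HE expr0 mul1r /c big_nat1 !qpoch0 !expr0 !mulr1 invr1 mul1r.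
  rewrite mul1r -[RHS](qprod_coef_sum n).
  by apply: eq_bigr => k _; rewrite expr1n mulr1.
have HN N : (n < N)%N -> series H N = 1 + e * \sum_(n.+1 <= l < N) F l.
  move=> nN; rewrite /series /= big_ltn ?(leq_ltn_trans _ nN) // H0.
  rewrite (big_cat_nat _ nN) //= [X in 1 + (X + _)]big_nat big1 ?add0r; last first.
    by move=> l ln; rewrite HE qprod_coef_vanish // mulr0.
  by rewrite mulr_sumr; congr (_ + _); apply: eq_big_nat => l /andP[nl _]; rewrite HF.
have cH : series H @ \oo --> gauss_quotient q * T.
  rewrite /T -bailey_beta_sum // mulr_sumr.
  rewrite (_ : series H = fun N => \sum_(0 <= k < n.+1) qprod_coef q n k * series (w k) N).
    apply: cvg_big => [|k _]; first exact: add_continuous.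
    rewrite mulrCA; apply: cvgM; first exact: cvg_cst.
    rewrite -(qbin_sum_mul s) //; apply: qbin_cauchy; rewrite ?normrN normrX.
      by rewrite exprn_ilt1.
    by rewrite exprn_ilt1.
  apply/funext => N; rewrite /series /= exchange_big; apply: eq_bigr => k _.
  by rewrite mulr_sumr.
exists ((gauss_quotient q * T - 1) / e); split; last first.
  by rewrite mulrCA divff // mulr1 addrC subrK.
(* [HN] holds from the index [n.+1] on. *)
rewrite -(cvg_shiftn n.+1).
rewrite (_ : [sequence _]_N = fun N => (series H (N + n.+1)%N - 1) / e).
  apply: cvgM (cvg_cst _); apply: cvgB (cvg_cst _).
  by rewrite (cvg_shiftn n.+1 (series H)).
apply/funext => N /=; rewrite HN ?ltn_addl // addrC addKr mulrC mulKf //.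
Qed.

End QBinomial.

(** * Geometrically bounded complex series *)

(** The norm of a complex number as a real number, so that estimates take place
    in a totally ordered archimedean field. *)
Definition nrm {R : realType} (z : Cplx R) : R := complex.Re (`|z| : R[i]).

Section Norm.
Context {R : realType}.
Implicit Types z w : Cplx R.

Lemma nrmE z : `|z| = ((nrm z)%:C)%C :> R[i].
Proof. by rewrite /nrm [`|z|]normc_def. Qed.

Lemma nrm_ge0 z : 0 <= nrm z.
Proof. by have := normr_ge0 z; rewrite nrmE lecR. Qed.

Lemma nrmM z w : nrm (z * w) = nrm z * nrm w.
Proof.
have /complexI // : ((nrm (z * w))%:C = (nrm z * nrm w)%:C)%C.
by rewrite rmorphM /= -!nrmE normrM.
Qed.

Lemma nrm1 : nrm (1 : Cplx R) = 1.
Proof. by rewrite /nrm normr1. Qed.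

Lemma nrmX z n : nrm (z ^+ n) = nrm z ^+ n.
Proof. by elim: n => [|n IHn]; rewrite ?nrm1 // !exprS nrmM IHn. Qed.

Lemma nrmN z : nrm (- z) = nrm z.
Proof. by rewrite /nrm normrN. Qed.

Lemma nrm_dist z w : nrm (z - w) = nrm (w - z).
Proof. by rewrite -nrmN opprB. Qed.

Lemma nrmD z w : nrm (z + w) <= nrm z + nrm w.
Proof. by rewrite -lecR rmorphD /= -!nrmE ler_normD. Qed.

Lemma nrm_lt1 z : (`|z| < 1) = (nrm z < 1).
Proof. by rewrite nrmE -ltcR. Qed.

Lemma nrm_sum (I : Type) (s : seq I) (u : I -> Cplx R) :
  nrm (\sum_(i <- s) u i) <= \sum_(i <- s) nrm (u i).
Proof.
elim: s => [|i s IHs]; first by rewrite !big_nil /nrm normr0.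
by rewrite !big_cons (le_trans (nrmD _ _)) // lerD2l.
Qed.

Lemma nrm_cvgP (u : nat -> Cplx R) (l : Cplx R) :
  u @ \oo --> l <-> (fun n => nrm (u n - l)) @ \oo --> (0 : R).
Proof.
split=> [/cvgrPdist_lt h | /cvgr0Pnorm_lt h].
  apply/cvgr0Pnorm_lt => e e0.
  have /h : 0 < (e%:C)%C :> Cplx R by rewrite ltcR.
  apply: filterS => n hn.
  by rewrite ger0_norm ?nrm_ge0 // nrm_dist -ltcR -nrmE.
apply/(@cvgrPdist_lt (Cplx R) (Cplx R)) => e e0; have /complex_realP[r er] := gtr0_real e0.
move: e0; rewrite er (ltcR 0) => /h; apply: filterS => n hn.
rewrite ger0_norm ?nrm_ge0 // nrm_dist -ltcR -nrmE in hn.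
exact: hn.
Qed.

Lemma nrm_cvg_le (u : nat -> Cplx R) (l : Cplx R) (e : nat -> R) :
  (forall n, nrm (u n - l) <= e n) -> e @ \oo --> (0 : R) -> u @ \oo --> l.
Proof.
move=> ule e0; apply/nrm_cvgP; apply: squeeze_cvgr (cvg_cst 0) e0.
by apply: nearW => n; rewrite nrm_ge0 ule.
Qed.

Lemma nrm_lim_le (u : nat -> Cplx R) (l c : Cplx R) (B : R) m :
  u @ \oo --> l -> (forall n, (m <= n)%N -> nrm (u n - c) <= B) ->
  nrm (l - c) <= B.
Proof.
move=> /nrm_cvgP ul uB; rewrite leNgt; apply/negP => Blt.
have e0 : 0 < nrm (l - c) - B by rewrite subr_gt0.
have /cvgr0Pnorm_lt /(_ _ e0) [N _ Nh] := ul.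
have := Nh (maxn m N) (leq_maxr _ _); rewrite /= ger0_norm ?nrm_ge0 //.
rewrite nrm_dist ltNge => /negP; apply.
rewrite lerBlDr (le_trans _ (lerD (lexx _) (uB _ (leq_maxl m N)))) //.
by rewrite (le_trans _ (nrmD _ _)) // addrA subrK.
Qed.

Lemma nrm_Re_Im z : `|complex.Re z| <= nrm z /\ `|complex.Im z| <= nrm z
  /\ nrm z <= `|complex.Re z| + `|complex.Im z|.
Proof.
rewrite /nrm [`|z|]normc_def /=; case: z => a b /=.
have ab0 : 0 <= a ^+ 2 + b ^+ 2 by rewrite addr_ge0 ?sqr_ge0.
split; first by rewrite -sqrtr_sqr ler_wsqrtr // lerDl sqr_ge0.
split; first by rewrite -sqrtr_sqr ler_wsqrtr // lerDr sqr_ge0.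
rewrite -[leRHS]ger0_norm ?addr_ge0 // -sqrtr_sqr ler_wsqrtr //.
rewrite sqrrD !real_normK ?num_real // -addrA [_ *+ 2 + _]addrC addrA lerDl.
by rewrite mulrn_wge0 // mulr_ge0.
Qed.

Definition geo_bounded (u : nat -> Cplx R) (C r : R) :=
  forall n, nrm (u n) <= C * r ^+ n.

Lemma geo_bounded_ge0 u C r : geo_bounded u C r -> 0 <= C.
Proof. by move=> /(_ 0%N); rewrite expr0 mulr1; apply: le_trans (nrm_ge0 _). Qed.

Lemma geo_bounded_le u C r s :
  0 <= r -> r <= s -> geo_bounded u C r -> geo_bounded u C s.
Proof.
move=> r0 rs h n; apply: le_trans (h n) _; apply: ler_wpM2l.
  exact: geo_bounded_ge0 h.
by rewrite lerXn2r // nnegrE // (le_trans r0).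
Qed.

(** Completeness of the complex numbers enters here only: the real and imaginary
    parts are dominated by a geometric series. *)
Lemma geo_bounded_cvg u C r :
  0 <= r -> r < 1 -> geo_bounded u C r -> cvgn (series u).
Proof.
move=> r0 r1 uC.
have part (f : R[i] -> R) : (forall z : Cplx R, `|f z| <= nrm z) ->
    cvgn (series (fun n => f (u n))).
  move=> fle; apply: normed_cvg; apply: (@series_le_cvg _ _ (geometric C r)).
  - by move=> n /=.
  - by move=> n; rewrite mulr_ge0 ?exprn_ge0 // (geo_bounded_ge0 _ _ _ uC).
  - by move=> n; apply: le_trans (fle _) (uC n).
  - by apply: is_cvg_geometric_series; rewrite ger0_norm.
have cRe := part (@complex.Re R) (fun z => proj1 (nrm_Re_Im z)).
have cIm := part (@complex.Im R) (fun z => proj1 (proj2 (nrm_Re_Im z))).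
pose l : Cplx R := (limn (series (fun n => complex.Re (u n))) +i*
  limn (series (fun n => complex.Im (u n))))%C.
apply/cvg_ex; exists l; apply: (@nrm_cvg_le _ _ (fun N =>
  `|series (fun n => complex.Re (u n)) N - complex.Re l| +
  `|series (fun n => complex.Im (u n)) N - complex.Im l|)).
  move=> N; apply: le_trans (proj2 (proj2 (nrm_Re_Im _))) _.
  have ReB (x y : Cplx R) : complex.Re (x - y) = complex.Re x - complex.Re y.
    exact: (raddfB (@complex.Re R)).
  have ImB (x y : Cplx R) : complex.Im (x - y) = complex.Im x - complex.Im y.
    exact: (raddfB (@complex.Im R)).
  rewrite ReB ImB /series /=.
  have -> : complex.Re (\sum_(0 <= k < N) u k) = \sum_(0 <= k < N) complex.Re (u k).
    exact: (raddf_sum (@complex.Re R)).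
  have -> : complex.Im (\sum_(0 <= k < N) u k) = \sum_(0 <= k < N) complex.Im (u k).
    exact: (raddf_sum (@complex.Im R)).
  by [].
rewrite -[X in _ --> X](addr0 0); apply: cvgD; rewrite -[X in _ --> X](@normr0 _ R).
  by apply: cvg_norm; rewrite -(subrr (complex.Re l)); apply: cvgB cRe (cvg_cst _).
by apply: cvg_norm; rewrite -(subrr (complex.Im l)); apply: cvgB cIm (cvg_cst _).
Qed.

Lemma geo_bounded_of_ratio (u : nat -> Cplx R) (r : R) N :
  0 < r -> (forall n, (N <= n)%N -> nrm (u n.+1) <= r * nrm (u n)) ->
  exists C, geo_bounded u C r.
Proof.
move=> r0; elim: N u => [|N IHN] u ur.
  exists (nrm (u 0%N)); elim=> [|n IHn]; first by rewrite mulr1.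
  by rewrite (le_trans (ur _ _)) // exprS mulrCA ler_wpM2l // ltW.
have [|C hC] := IHN (fun n => u n.+1); first by move=> n Nn; apply: ur.
exists (Num.max (nrm (u 0%N)) (C / r)) => -[|n].
  by rewrite mulr1 le_max lexx.
rewrite (le_trans (hC n)) // exprS mulrA ler_wpM2r ?exprn_ge0 ?(ltW r0) //.
by rewrite -ler_pdivrMr // le_max lexx orbT.
Qed.

Lemma geo_bounded_sum u C r m N : 0 <= r -> r < 1 -> geo_bounded u C r ->
  nrm (\sum_(m <= j < N) u j) <= C / (1 - r) * r ^+ m.
Proof.
move=> r0 r1 uC; have C0 := geo_bounded_ge0 _ _ _ uC.
have r10 : 0 < 1 - r by rewrite subr_gt0.
have [Nm|mN] := leqP N m.
  rewrite big_geq // /nrm normr0 mulr_ge0 ?exprn_ge0 // divr_ge0 //.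
  exact: ltW.
apply: le_trans (nrm_sum _ _ _) _.
apply: le_trans (ler_sum _ (fun j _ => uC j)) _.
rewrite -mulr_sumr -mulrA ler_wpM2l //.
rewrite ler_pdivlMl // mulr_sumr.
rewrite (eq_bigr (fun j => - (r ^+ j.+1 - r ^+ j))); last first.
  by move=> j _; rewrite mulrBl mul1r exprS opprB.
rewrite sumrN telescope_sumr ?(ltnW mN) // opprB lerBlDr lerDl.
exact: exprn_ge0.
Qed.

Lemma geo_bounded_tail u C r m : 0 <= r -> r < 1 -> geo_bounded u C r ->
  nrm (limn (series u) - series u m) <= C / (1 - r) * r ^+ m.
Proof.
move=> r0 r1 uC; have cu : cvgn (series u) := geo_bounded_cvg _ _ _ r0 r1 uC.
apply: (nrm_lim_le _ _ _ _ m cu) => n mn.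
by rewrite sub_series_geq // geo_bounded_sum.
Qed.

(** With [s] a square root of [r], [n%:R * s ^+ n] is at most the sum of the
    geometric series of ratio [s]. *)
Lemma cvg_natmul_expr (r : R) : 0 <= r -> r < 1 ->
  (fun n => n%:R * r ^+ n) @ \oo --> (0 : R).
Proof.
move=> r0 r1; pose s := Num.sqrt r.
have s0 : 0 <= s by apply: sqrtr_ge0.
have s1 : s < 1 by rewrite -sqrtr1 ltr_sqrt.
have sr : r = s ^+ 2 by rewrite sqr_sqrtr.
have s10 : 0 < 1 - s by rewrite subr_gt0.
apply: (@squeeze_cvgr _ _ _ _ (fun=> 0) (geometric (1 - s)^-1 s)).
- apply: nearW => n; rewrite mulr_ge0 ?exprn_ge0 //= sr exprAC expr2 mulrA.
  rewrite ler_wpM2r ?exprn_ge0 // -[leRHS]mul1r ler_pdivlMr //.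
  rewrite mulrC mulr_natl -[n in _ *+ n]subn0 -sumr_const_nat mulr_sumr.
  apply: (@le_trans _ _ (\sum_(0 <= j < n) - (s ^+ j.+1 - s ^+ j))).
    apply: ler_sum_nat => j /andP[_ jn].
    have -> : - (s ^+ j.+1 - s ^+ j) = (1 - s) * s ^+ j.
      by rewrite mulrBl mul1r exprS opprB.
    by rewrite ler_wpM2l ?(ltW s10) // ler_wiXn2l ?(ltW s1) ?(ltnW jn).
  by rewrite sumrN telescope_sumr // opprB lerBlDr lerDl exprn_ge0.
- exact: cvg_cst.
- by apply: cvg_geometric; rewrite ger0_norm.
Qed.

Lemma series_cauchy_prod (u v : nat -> Cplx R) N :
  series (fun l => \sum_(0 <= j < l.+1) u j * v (l - j)%N) N =
  \sum_(0 <= j < N) u j * series v (N - j)%N.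
Proof.
elim: N => [|N IHN]; first by rewrite /series /= !big_geq.
rewrite seriesSr IHN !big_nat_recr //= addrA -big_split /=.
congr (_ + _); last by rewrite subSnn subnn seriesSr /series /= big_geq // add0r.
by apply: eq_big_nat => j /andP[_ jN]; rewrite subSn ?(ltnW jN) // seriesSr mulrDr.
Qed.

(** With [V] the sum of [v], the partial sum of [u] times [V] minus the partial
    sum of the Cauchy product is a sum of [N] terms [u j * (V - V_(N - j))], each
    bounded by a multiple of [r ^+ N] because the tails of [v] are geometrically
    small. *)
Lemma cvg_cauchy_prod (u v : nat -> Cplx R) (C D r : R) :
  0 <= r -> r < 1 -> geo_bounded u C r -> geo_bounded v D r ->
  series (fun l => \sum_(0 <= j < l.+1) u j * v (l - j)%N) @ \oo -->
  limn (series u) * limn (series v).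
Proof.
move=> r0 r1 uC vD.
have cu : cvgn (series u) := geo_bounded_cvg _ _ _ r0 r1 uC.
have C0 := geo_bounded_ge0 _ _ _ uC.
pose V := limn (series v); pose E N := series u N * V -
  series (fun l => \sum_(0 <= j < l.+1) u j * v (l - j)%N) N.
have E0 : E @ \oo --> (0 : Cplx R).
  apply: (@nrm_cvg_le _ _ (fun N => C * (D / (1 - r)) * (N%:R * r ^+ N))).
    move=> N; rewrite subr0 /E series_cauchy_prod [series u N]/series /=.
    rewrite mulr_suml -sumrB; apply: le_trans (nrm_sum _ _ _) _.
    rewrite mulrCA -[N in N%:R]subn0 mulr_natl -sumr_const_nat.
    apply: ler_sum_nat => j /andP[_ jN]; rewrite -mulrBr nrmM.
    rewrite -[in r ^+ _](subnKC (ltnW jN)) exprD mulrACA.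
    apply: ler_pM => //; rewrite ?nrm_ge0 //.
    exact: geo_bounded_tail.
  rewrite -[X in _ --> X](mulr0 (C * (D / (1 - r)))).
  by apply: cvgM; [exact: cvg_cst | exact: cvg_natmul_expr].
have -> : series (fun l => \sum_(0 <= j < l.+1) u j * v (l - j)%N) =
    (fun N => series u N * V - E N).
  by apply/funext => N; rewrite /E opprB addrC subrK.
rewrite -[X in _ --> X]subr0; apply: cvgB E0.
by apply: cvgM cu (cvg_cst _).
Qed.

(** A power series is continuous at 0: without its constant term it is
    bounded by a multiple of its argument. *)
Lemma cvg_pseries0 u C r (x : Cplx R) : 0 <= r -> r < 1 -> geo_bounded u C r ->
  nrm x < 1 ->
  (fun m => limn (series (fun j => u j * (x ^+ m) ^+ j))) @ \oo --> u 0%N.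
Proof.
move=> r0 r1 uC x1; have C0 := geo_bounded_ge0 _ _ _ uC.
have xg m : nrm (x ^+ m) <= 1 by rewrite nrmX exprn_ile1 ?nrm_ge0 // ltW.
have r10 : 0 < 1 - r by rewrite subr_gt0.
apply: (@nrm_cvg_le _ _ (geometric (C / (1 - r)) (nrm x))); last first.
  by apply: cvg_geometric; rewrite ger0_norm ?nrm_ge0.
move=> m; set t := x ^+ m; pose s := r * nrm t.
have s0 : 0 <= s by rewrite mulr_ge0 ?nrm_ge0.
have sr : s <= r by rewrite ler_piMr //; apply: xg.
have s1 : s < 1 by apply: le_lt_trans r1.
have uts : geo_bounded (fun j => u j * t ^+ j) C s.
  by move=> j; rewrite nrmM nrmX exprMn mulrA ler_wpM2r ?exprn_ge0 ?nrm_ge0.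
have := geo_bounded_tail _ _ _ 1 s0 s1 uts.
rewrite [series _ 1]/series /= big_nat1 expr0 mulr1 expr1 => /le_trans; apply.
rewrite /geometric /= -nrmX -/t -!mulrA ler_wpM2l //.
have s10 : 0 < 1 - s by rewrite subr_gt0.
apply: ler_pM => //; first by rewrite invr_ge0 ltW.
  by rewrite lef_pV2 ?posrE // lerD2l lerN2.
by rewrite ler_piMl ?nrm_ge0 // ltW.
Qed.

End Norm.

Section ComplexQBinomial.
Context {R : realType} {q : Cplx R}.
Hypothesis q1 : nrm q < 1.

Let q1' : `|q| < 1. Proof. by rewrite nrm_lt1. Qed.

Let nz l : qpoch q q l != 0. Proof. by rewrite qpoch_neq0 // ltW. Qed.

Let nz1 l : 1 - q * q ^+ l != 0.
Proof. by apply: contraNneq (nz l.+1) => h; rewrite qpochS h mulr0. Qed.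

(** The ratio of consecutive terms tends to [y], so its norm is eventually below
    any [r] between [nrm y] and 1. *)
Lemma qbin_term_geo a y : nrm y < 1 ->
  exists C r, [/\ 0 <= r, r < 1 & geo_bounded (qbin_term q a y) C r].
Proof.
move=> y1; pose r := (1 + nrm y) / 2; have y0 := nrm_ge0 y.
have yr : nrm y < r by rewrite ltr_pdivlMr // mulr_natr mulr2n ltrD2r.
have r1 : r < 1 by rewrite ltr_pdivrMr // mul1r -natr1 addrC ltrD2r.
have r0 : 0 < r by apply: le_lt_trans yr.
have q0 := nrm_ge0 q.
pose D := nrm a * nrm y + r * nrm q.
have /cvgr0Pnorm_lt h : geometric D (nrm q) @ \oo --> (0 : R).
  by apply: cvg_geometric; rewrite ger0_norm.
have /h [N _ Nh] : 0 < r - nrm y by rewrite subr_gt0.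
have [|C hC] := @geo_bounded_of_ratio _ (qbin_term q a y) r N r0.
  move=> n Nn; have := Nh n Nn; rewrite /= => /ltW /(le_trans (ler_norm _)) hn.
  pose c := qbin_term q a y n / (1 - q * q ^+ n).
  have -> : qbin_term q a y n.+1 = c * ((1 - a * q ^+ n) * y).
    rewrite /c /qbin_term !qpochS exprS; field; rewrite nz nz1 //.
  have -> : qbin_term q a y n = c * (1 - q * q ^+ n) by rewrite /c divfK.
  clearbody c; rewrite !nrmM [leRHS]mulrCA; apply: ler_wpM2l; first exact: nrm_ge0.
  have h1 : nrm (1 - a * q ^+ n) <= 1 + nrm a * nrm q ^+ n.
    by rewrite -nrmX -nrmM -(nrmN (a * _)) -(@nrm1 R) nrmD.
  have h2 : 1 - nrm q * nrm q ^+ n <= nrm (1 - q * q ^+ n).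
    rewrite lerBlDr -nrmX -nrmM -{1}(@nrm1 R).
    by rewrite -{1}(subrK (q * q ^+ n) 1) nrmD.
  apply: le_trans (ler_wpM2r y0 h1) _.
  apply: le_trans (ler_wpM2l (ltW r0) h2).
  rewrite mulrDl mul1r mulrBr mulr1 lerBrDr -addrA.
  by rewrite -lerBrDl (le_trans _ hn) // /D mulrDl !mulrA [nrm a * nrm y * _]mulrAC.
by exists C, r; rewrite ltW.
Qed.

Lemma qbin_sum_cvg1 a y : nrm y < 1 ->
  (fun m => qbin_sum q a (y * q ^+ m)) @ \oo --> (1 : Cplx R).
Proof.
move=> y1; have [C [r [r0 r1 h]]] := qbin_term_geo a _ y1.
have h0 := cvg_pseries0 _ _ _ q r0 r1 h q1.
have e0 : qbin_term q a y 0 = 1 by rewrite /qbin_term !qpoch0 expr0 mulr1 divr1.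
rewrite e0 in h0.
have -> : (fun m => qbin_sum q a (y * q ^+ m)) =
    (fun m => limn (series (fun j => qbin_term q a y j * (q ^+ m) ^+ j))).
  apply/funext => m; rewrite /qbin_sum.
  have -> : qbin_term q a (y * q ^+ m) = fun j => qbin_term q a y j * (q ^+ m) ^+ j.
    by apply/funext => j; rewrite /qbin_term exprMn [LHS]mulrA.
  by [].
exact: h0.
Qed.

Lemma qbin_term_cvg a y : nrm y < 1 -> cvgn (series (qbin_term q a y)).
Proof. by move=> /(qbin_term_geo a)[C [r [r0 r1]]]; apply: geo_bounded_cvg. Qed.

Lemma qbin_term_cauchy a y b z : nrm y < 1 -> nrm z < 1 ->
  series (fun l => \sum_(0 <= j < l.+1)
                     qbin_term q a y j * qbin_term q b z (l - j)) @ \oo -->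
  qbin_sum q a y * qbin_sum q b z.
Proof.
move=> /(qbin_term_geo a)[C [r [r0 r1 hr]]] /(qbin_term_geo b)[D [t [t0 t1 ht]]].
apply: (@cvg_cauchy_prod _ _ _ C D (Num.max r t)).
- by rewrite le_max r0.
- by rewrite gt_max r1.
- by apply: geo_bounded_le hr; rewrite // le_max lexx.
- by apply: geo_bounded_le ht; rewrite // le_max lexx orbT.
Qed.

End ComplexQBinomial.

Lemma triangular_bin j : ((j * j.+1) %/ 2)%N = 'C(j.+1, 2).
Proof. by rewrite bin2 divn2 mulnC. Qed.

(* s is the fixed square root q^{1/2}, so that q^{-n-1/2} = s ^- (2n+1). *)
Theorem theorem1p1 (R : realType) (q s : Cplx R)
    (hq : 0 < `|q| < 1) (hs : s ^+ 2 = q) (n : nat) :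
  let F := fun l : nat =>
    (- q) ^+ l *
    (\sum_(0 <= j < l.+1)
       (qpoch (s ^- (2 * n + 1)) q j * qpoch s q (l - j)) /
       (qpoch q q j * qpoch q q (l - j)) * (- q ^+ n.+1) ^+ j) *
    qbinom q l.-1 n in
  cvgn (fun N : nat => \sum_(n.+1 <= l < N) F l) /\
  qpoch_inf q (q ^+ 2) / qpoch_inf (q ^+ 2) (q ^+ 2) *
    (\sum_(0 <= j < n.+1) q ^+ ((j * j.+1) %/ 2)) =
  1 + (-1) ^+ n * q ^+ ((n * n.+1) %/ 2) *
      limn (fun N : nat => \sum_(n.+1 <= l < N) F l).
Proof.
move=> F; have [q0 q1] := andP hq.
have n1 : nrm q < 1 by rewrite -nrm_lt1.
have cvg_ a y : `|y| < 1 -> cvgn (series (qbin_term q a y)).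
  by rewrite nrm_lt1; exact: qbin_term_cvg.
have cvg1_ a y : `|y| < 1 ->
    (fun m => qbin_sum q a (y * q ^+ m)) @ \oo --> (1 : Cplx R).
  by rewrite nrm_lt1; exact: qbin_sum_cvg1.
have cauchy_ a y b z : `|y| < 1 -> `|z| < 1 ->
    series (fun l => \sum_(0 <= j < l.+1)
                       qbin_term q a y j * qbin_term q b z (l - j)) @ \oo -->
    qbin_sum q a y * qbin_sum q b z.
  by rewrite !nrm_lt1; exact: qbin_term_cauchy.
have qn0 : q != 0 by rewrite -normr_gt0.
have [L [FL FE]] := partial_theta_expansion q1 cvg_ cvg1_ cauchy_ s n qn0 hs.
split; first by apply/cvg_ex; exists L.
rewrite (cvg_lim (@norm_hausdorff _ _) FL) triangular_bin -FE.
by congr (_ * _); apply: eq_bigr => j _; rewrite triangular_bin.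
Qed.
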